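(* Let $A$ be a finite alphabet of size at least $2$ and let $k$ be a positive integer. Then, with respect to either the sum length stratification or the maximum length stratification, the monoid defined by the generic $A$-generated $k$-relation monoid presentation is non-trivial, torsion-free and $\mathscr{J}$-trivial. In particular, it is not a group, an inverse monoid or a regular monoid. The corresponding statements for semigroups also hold: with respect to either stratification, the semigroup defined by the generic $A$-generated $k$-relation semigroup presentation is non-trivial, torsion-free and $\mathscr{J}$-trivial, and in particular is not a group, an inverse semigroup or a regular semigroup.
   Context: An $A$-generated $k$-relation monoid presentation consists of the finite alphabet $A$ and a finite sequence $R$ of $k$ ordered pairs of words in $A^*$; it defines the monoid $A^*/\equiv_R$, where $\equiv_R$ is the congruence on $A^*$ generated by $R$. An $A$-generated $k$-relation semigroup presentation is defined in the same way using non-empty words ($A^+$ in place of $A^*$), and defines the semigroup $A^+/\equiv_R$. The relation words are the $2k$ words occurring as sides of the relations. Let $S$ be the set of all such monoid (respectively, semigroup) presentations. The sum length (respectively, maximum length) stratification of $S$ is the sequence $(S_n)$ where $S_n$ is the finite set of presentations in $S$ whose sum of relation word lengths (respectively, length of longest relation word) is exactly $n$. A subset $X\subseteq S$ is generic if $\lim_{n\to\infty}|X\cap S_n|/|S_n|=1$. ''The generic presentation has property $Y$'' means that there is a generic subset of $S$ every member of which has property $Y$. A monoid or semigroup is $\mathscr{J}$-trivial if distinct elements always generate distinct principal two-sided ideals. A torsion element is one which generates a finite subsemigroup; a monoid or semigroup is torsion-free if it has no non-identity torsion elements. *)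

(* Defs.v *)
From HB Require Import structures.
From mathcomp Require Import all_boot all_order all_algebra all_fingroup.
From mathcomp Require Import generic_quotient finmap.
From mathcomp Require Import all_classical all_reals all_analysis.
Import numFieldNormedType.Exports.

Set Implicit Arguments.
Unset Strict Implicit.
Unset Printing Implicit Defensive.

Local Open Scope classical_set_scope.
Local Open Scope group_scope.

(* The free monoid on A: words under concatenation, with unit [::]. *)
Definition word (A : finType) := seq A.

Section FreeMonoid.
Variable A : finType.

HB.instance Definition _ := Choice.on (word A).

Fact word_mulA : associative (@cat A : word A -> word A -> word A).
Proof. exact: catA. Qed.
Fact word_mul1 : left_id ([::] : word A) (@cat A).
Proof. exact: cat0s. Qed.
Fact word_mulg1 : right_id ([::] : word A) (@cat A).
Proof. exact: cats0. Qed.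

HB.instance Definition _ := isMonoid.Build (word A) word_mulA word_mul1 word_mulg1.

End FreeMonoid.

Record neword (A : finType) :=
  NEWord { neword_val :> word A; neword_neq0 : neword_val != [::] }.

Section FreeSemigroup.
Variable A : finType.

HB.instance Definition _ := [isSub for @neword_val A].
HB.instance Definition _ := [Choice of neword A by <:].

Definition neword_mul (u v : neword A) : neword A.
Proof.
exists ((u : word A) * (v : word A)).
by case: u => -[].
Defined.

Fact neword_mulA : associative neword_mul.
Proof. by move=> u v w; apply: val_inj; rewrite /= mulgA. Qed.

HB.instance Definition _ := isSemigroup.Build (neword A) neword_mulA.

End FreeSemigroup.

Section Quotient.
Variable S : semigroupType.

Definition congruence (E : set (S * S)) :=
  [/\ forall x, E (x, x),
      forall x y, E (x, y) -> E (y, x),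
      forall x y z, E (x, y) -> E (y, z) -> E (x, z)
    & forall x x' y y', E (x, x') -> E (y, y') -> E (x * y, x' * y')].

Definition gen_congruence (R : set (S * S)) : set (S * S) :=
  smallest congruence R.

Lemma gen_congruenceP R : congruence (gen_congruence R).
Proof.
split.
- by move=> x E [[rE _ _ _] _].
- by move=> x y xy E [cE RE]; case: (cE) => _ sE _ _; apply: (sE _ _ (xy _ _)).
- move=> x y z xy yz E [cE RE]; case: (cE) => _ _ tE _.
  by apply: (tE _ _ _ (xy _ _) (yz _ _)).
- move=> x x' y y' xx' yy' E [cE RE]; case: (cE) => _ _ _ mE.
  by apply: (mE _ _ _ _ (xx' _ _) (yy' _ _)).
Qed.

Variable R : set (S * S).

Definition gen_congruenceb : rel S :=
  fun x y => `[< gen_congruence R (x, y) >].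

Fact gen_congruenceb_refl : reflexive gen_congruenceb.
Proof. by move=> x; apply/asboolP; case: (gen_congruenceP R). Qed.
Fact gen_congruenceb_sym : symmetric gen_congruenceb.
Proof.
by case: (gen_congruenceP R) => _ sE _ _ x y;
  apply/idP/idP => /asboolP xy; apply/asboolP; apply: sE.
Qed.
Fact gen_congruenceb_trans : transitive gen_congruenceb.
Proof.
case: (gen_congruenceP R) => _ _ tE _ y x z /asboolP xy /asboolP yz.
by apply/asboolP; apply: (tE _ y).
Qed.

Canonical gen_congruence_equiv := EquivRel gen_congruenceb
  gen_congruenceb_refl gen_congruenceb_sym gen_congruenceb_trans.

Local Open Scope quotient_scope.

Definition cquot := {eq_quot gen_congruence_equiv}.
HB.instance Definition _ := Choice.on cquot.
HB.instance Definition _ := EqQuotient.on cquot.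

Lemma cquot_eqP (x y : S) :
  \pi_cquot x = \pi_cquot y <-> gen_congruence R (x, y).
Proof.
by split=> [/eqquotP/asboolP|xy] //; apply/eqquotP/asboolP.
Qed.

Definition cquot_mul (a b : cquot) : cquot := \pi_cquot (repr a * repr b).

Lemma cquot_piM (x y : S) :
  cquot_mul (\pi_cquot x) (\pi_cquot y) = \pi_cquot (x * y).
Proof.
case: (gen_congruenceP R) => _ _ _ mE.
by apply/cquot_eqP; apply: mE; apply/cquot_eqP; rewrite reprK.
Qed.

Fact cquot_mulA : associative cquot_mul.
Proof.
elim/quotW=> x; elim/quotW=> y; elim/quotW=> z.
rewrite (cquot_piM y z) (cquot_piM x y) (cquot_piM x (y * z)).
by rewrite (cquot_piM (x * y) z) mulgA.
Qed.

HB.instance Definition _ := isSemigroup.Build cquot cquot_mulA.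

End Quotient.

Section MonoidQuotient.
Variables (M : monoidType) (R : set (M * M)).
Local Open Scope quotient_scope.

Definition cquot_one : cquot R := \pi_(cquot R) 1.

Fact cquot_mul1 : left_id cquot_one (@cquot_mul M R).
Proof. by elim/quotW=> x; rewrite /cquot_one (cquot_piM R 1 x) mul1g. Qed.
Fact cquot_mulg1 : right_id cquot_one (@cquot_mul M R).
Proof. by elim/quotW=> x; rewrite /cquot_one (cquot_piM R x 1) mulg1. Qed.

HB.instance Definition _ :=
  Semigroup_isMonoid.Build (cquot R) cquot_mul1 cquot_mulg1.

End MonoidQuotient.

(* Semigroup-theoretic notions; they apply to monoids through the coercion
   from [monoidType] to [semigroupType]. *)
Section Notions.
Variable S : semigroupType.

Definition nontrivial := exists x y : S, x <> y.

Definition ideal (I : set S) :=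
  forall x s, I x -> I (s * x) /\ I (x * s).

Definition principal_ideal (a : S) : set S := smallest ideal [set a].

Definition J_trivial := injective principal_ideal.

Definition subsemigroup (T : set S) := forall x y, T x -> T y -> T (x * y).

Definition torsion (a : S) := finite_set (smallest subsemigroup [set a]).

(* A semigroup need not have an identity; in a monoid this says [e = 1]. *)
Definition is_identity (e : S) := forall x, e * x = x /\ x * e = x.

Definition torsion_free := forall a, torsion a -> is_identity a.

Definition is_group :=
  exists2 e, is_identity e & forall x, exists y, x * y = e /\ y * x = e.

Definition is_inverse :=
  forall x : S, exists! y, x * y * x = x /\ y * x * y = y.

Definition is_regular := forall x : S, exists y, x * y * x = x.

End Notions.

(* With [T] the free monoid (resp. semigroup) on an alphabet, these are the
   k-relation monoid (resp. semigroup) presentations on that alphabet. *)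
Definition presentation (T : Type) (k : nat) := k.-tuple (T * T)%type.

Definition monoid_presentation (A : finType) := presentation (word A).
Definition semigroup_presentation (A : finType) := presentation (neword A).

HB.instance Definition _ (T : choiceType) k := Choice.on (presentation T k).
HB.instance Definition _ A k := Choice.on (monoid_presentation A k).
HB.instance Definition _ A k := Choice.on (semigroup_presentation A k).

Definition presented_monoid (A : finType) (k : nat)
    (p : monoid_presentation A k) : monoidType :=
  cquot [set r | r \in (p : seq (word A * word A))].

Definition presented_semigroup (A : finType) (k : nat)
    (p : semigroup_presentation A k) : semigroupType :=
  cquot [set r | r \in (p : seq (neword A * neword A))].

Variant stratification := SumLength | MaxLength.

Definition presentation_size (T : Type) (len : T -> nat) (k : nat)
    (st : stratification) (p : presentation T k) : nat :=
  match st with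
  | SumLength => \sum_(r <- p) (len r.1 + len r.2)
  | MaxLength => \max_(r <- p) maxn (len r.1) (len r.2)
  end.

Definition monoid_stratum (A : finType) (k : nat) (st : stratification)
    (n : nat) : set (monoid_presentation A k) :=
  [set p | presentation_size (fun w : word A => size w) st p = n].

Definition semigroup_stratum (A : finType) (k : nat) (st : stratification)
    (n : nat) : set (semigroup_presentation A k) :=
  [set p | presentation_size (fun w : neword A => size (neword_val w)) st p = n].

(* [fset_set] is the empty set on infinite arguments; the lemmas
   [monoid_stratum_finite] and [semigroup_stratum_finite] show that this never
   occurs below. For the finitely many n whose stratum is empty the quotient is
   0 by convention, which does not affect the limit. *)
Definition generic (R : realType) (P : choiceType) (strat : nat -> set P)
    (X : set P) :=
  (fun n => #|` fset_set (X `&` strat n)|%:R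
            / #|` fset_set (strat n)|%:R : R)%R @ \oo --> (1%R : R).

Definition generically (R : realType) (P : choiceType) (strat : nat -> set P)
    (Y : set P) :=
  exists2 X : set P, generic R strat X & X `<=` Y.

Lemma presentation_size_ge (T : eqType) (len : T -> nat) k st
    (p : presentation T k) (r : T * T) :
  r \in (p : seq (T * T)) ->
  (len r.1 <= presentation_size len st p)%N
  /\ (len r.2 <= presentation_size len st p)%N.
Proof.
move=> rp; case: st => /=.
- rewrite (big_rem r) //=; split; apply: leq_trans (leq_addr _ _).
  + exact: leq_addr.
  + exact: leq_addl.
- have H : (maxn (len r.1) (len r.2)
            <= \max_(r <- p) maxn (len r.1) (len r.2))%N.
    exact: (@leq_bigmax_seq _ p xpredT
              (fun r => maxn (len r.1) (len r.2)) r rp isT).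
  by move: H; rewrite geq_max => /andP.
Qed.

Lemma monoid_stratum_finite A k st n : finite_set (@monoid_stratum A k st n).
Proof.
pose g (w : word A) : n.-bseq A := insub_bseq n w.
pose f (t : k.-tuple (n.-bseq A * n.-bseq A)) : monoid_presentation A k :=
  map_tuple (fun r => (bseqval r.1 : word A, bseqval r.2 : word A)) t.
apply: (@sub_finite_set _ _ (f @` setT)); last exact/finite_image/finite_finset.
move=> p /= pn; exists (map_tuple (fun r => (g r.1, g r.2)) p) => //.
apply: val_inj; rewrite /= -map_comp -[RHS]map_id; apply/eq_in_map => r rp.
have [] := presentation_size_ge (fun w : word A => size w) st rp.
rewrite pn /= => r1 r2.
by rewrite /g /insub_bseq /insubd !insubT /=; case: (r).
Qed.

Lemma semigroup_stratum_finite A k st n :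
  finite_set (@semigroup_stratum A k st n).
Proof.
pose h (p : semigroup_presentation A k) : monoid_presentation A k :=
  map_tuple (fun r => (neword_val r.1, neword_val r.2)) p.
have h_inj : injective h.
  move=> p q /(congr1 val) /= pq; apply: val_inj; apply: inj_map pq.
  by move=> [a b] [c d] /= [/val_inj -> /val_inj ->].
apply: (@sub_finite_set _ _ (h @^-1` monoid_stratum st n)).
  by move=> p; rewrite /semigroup_stratum /monoid_stratum /=;
    case: st; rewrite /= big_map.
apply: finite_preimage; last exact: monoid_stratum_finite.
by move=> ? ? _ _; apply: h_inj.
Qed.

(* Main.v *)
Require Import Defs.
From mathcomp Require Import all_boot all_order all_algebra all_fingroup.
From mathcomp Require Import generic_quotient finmap.
From mathcomp Require Import all_classical all_reals all_analysis.
From mathcomp Require Import zify.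

(* With probability tending to 1 there is an L such that every relation word is
   longer than 3L and every word of length greater than L has at most one
   occurrence in the relation words: a presentation violating this is the image
   of many others under moving letters into a short relation word, or under
   overwriting one of two equal factors arbitrarily.

   For such a presentation every congruence class is finite. Starting from a
   word w, each word reached by rewriting is a concatenation of untouched
   letters of w and of relation words trimmed by at most L letters at each end,
   two adjacent trimmed words never being both trimmed where they meet. An
   occurrence of a relation word either absorbs at least one untouched letter or
   restores a trimmed word, so the number of tokens in such a decomposition
   never increases.

   Hence the maximal length of a representative is a superadditive function on
   the quotient, which vanishes at most at the identity; torsion-freeness and
   J-triviality follow. *)

Set Implicit Arguments.
Unset Strict Implicit.
Unset Printing Implicit Defensive.

Local Open Scope classical_set_scope.

(** * Token decompositions and their behaviour under one rewriting step *)

Section SmallOverlap.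
Variables (A : Type) (rel_word : seq A -> Prop) (L : nat).

(** Relation words form a predicate, not a family, so a word used as several sides counts once.
    Equality of both contexts says that a long factor determines its relation word and its position
    in it. *)
Definition small_overlap :=
  (forall u, rel_word u -> 3 * L < size u) /\
  (forall p f q p' q', rel_word (p ++ f ++ q) -> rel_word (p' ++ f ++ q') ->
     L < size f -> p = p' /\ q = q').

(* [Block l b r] stands for the relation word [l ++ b ++ r] trimmed to [b]. *)
Inductive token := Letter of A | Block of seq A & seq A & seq A.

Definition token_word t :=
  match t with Letter a => [:: a] | Block _ b _ => b end.

Definition yield ts := flatten (map token_word ts).

Definition token_wf t :=
  if t is Block l b r then
    [/\ rel_word (l ++ b ++ r), size l <= L & size r <= L]
  else True.

(** An end gets trimmed only when a freshly inserted, uncut relation word overlaps it. So next to a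
    letter there is no trimming, and where two blocks meet at most one is trimmed. *)
Definition compatible t t' : bool :=
  match t, t' with
  | Letter _, Letter _ => true
  | Letter _, Block l _ _ => nilp l
  | Block _ _ r, Letter _ => nilp r
  | Block _ _ r, Block l _ _ => nilp r || nilp l
  end.

Fixpoint wf ts :=
  if ts is t :: s then
    [/\ token_wf t, wf s & if s is t' :: _ then compatible t t' else true]
  else True.

Lemma yield_cat s t : yield (s ++ t) = yield s ++ yield t.
Proof. by rewrite /yield map_cat flatten_cat. Qed.

Lemma yield_cons t ts : yield (t :: ts) = token_word t ++ yield ts.
Proof. by []. Qed.

Lemma wf_cat s t : wf (s ++ t) -> wf s /\ wf t.
Proof.
elim: s => //= x s IH [wx /IH[ws wt] c]; split=> //; split=> //.
by case: s c {IH ws}.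
Qed.

Lemma wf_cat_cons s t ts : wf (rcons s t) -> wf (t :: ts) -> wf (s ++ t :: ts).
Proof.
elim: s => [|x s IH] //= wxs wts.
case: wxs => wx ws c; split => //; first exact: IH.
by case: s ws c {IH} => [|y s].
Qed.

Lemma wf_rcons_uncut s b : rel_word b -> wf s -> wf (rcons s (Block [::] b [::])).
Proof.
move=> rb; elim: s => [|x s IH] ws.
  by split=> //; split; rewrite ?cats0.
case: ws => wx ws c; split=> //; first exact: IH.
case: s c {IH ws} => [|y s] //= _.
by case: x {wx} => //= l x r; rewrite orbT.
Qed.

Lemma wf_uncut_cons s b : rel_word b -> wf s -> wf (Block [::] b [::] :: s).
Proof.
move=> rb ws; split=> //; first by split; rewrite ?cats0.
by case: s ws => // -[].
Qed.

Lemma wf_rcons_block s l b r b' r' t :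
  wf (s ++ Block l b r :: t) -> token_wf (Block l b' r') ->
  wf (rcons s (Block l b' r')).
Proof.
elim: s => [|x s IH] //= [wx ws c] wb; split=> //; first exact: IH.
by case: s c {IH ws}.
Qed.

Lemma split_yield ts x y : yield ts = x ++ y ->
  (exists s t, [/\ ts = s ++ t, yield s = x & yield t = y]) \/
  (exists s l c d r t, [/\ ts = s ++ Block l (c ++ d) r :: t,
     x = yield s ++ c, y = d ++ yield t, c <> [::] & d <> [::]]).
Proof.
elim: ts x => [|t ts IH] x.
  by case: x => // ; case: y => // _; left; exists [::], [::].
case: x => [|a x]; first by move=> e; left; exists [::], (t :: ts).
have recur x' : a :: x = token_word t ++ x' -> yield ts = x' ++ y ->
    (exists s t0, [/\ t :: ts = s ++ t0, yield s = a :: x & yield t0 = y]) \/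
    (exists s l c d r t0, [/\ t :: ts = s ++ Block l (c ++ d) r :: t0,
       a :: x = yield s ++ c, y = d ++ yield t0, c <> [::] & d <> [::]]).
  move=> -> /IH [[s [u [-> <- <-]]]|[s [l [c [d [r [u [-> -> -> nc nd]]]]]]]].
    by left; exists (t :: s), u.
  by right; exists (t :: s), l, c, d, r, u; rewrite yield_cons catA.
have [sz|sz] := leqP (size (token_word t)) (size (a :: x)); rewrite yield_cons.
  rewrite -{1}(cat_take_drop (size (token_word t)) (a :: x)) -catA => eq_xy.
  have [e1 e2] : token_word t = take (size (token_word t)) (a :: x) /\
      yield ts = drop (size (token_word t)) (a :: x) ++ y.
    move: eq_xy; move: (size_takel sz).
    move: (take _ _) (drop _ _) => u v szu e; split.
      by move/(congr1 (take (size u))): e; rewrite take_size_cat // szu take_size_cat.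
    by move/(congr1 (drop (size u))): e; rewrite drop_size_cat // szu drop_size_cat.
  by apply: recur e2; rewrite {1}e1 cat_take_drop.
case: t recur sz => [b|l b r] _ //= sz eq_xy.
right; exists [::], l, (a :: x), (drop (size x).+1 b), r, ts.
have e1 : a :: x = take (size x).+1 b.
  move/(congr1 (take (size x).+1)): eq_xy; rewrite takel_cat ?(ltnW sz)//.
  by rewrite -cat_cons take_size_cat.
split=> //=.
- by rewrite -cat_cons e1 cat_take_drop.
- move: eq_xy; rewrite -{1}(cat_take_drop (size x).+1 b) -e1 -catA.
  by move/(congr1 (drop (size x).+1)); rewrite -cat_cons !drop_size_cat.
- by move/(congr1 size); rewrite size_drop /=; apply/eqP; rewrite subn_eq0 -ltnNge.
Qed.

Hypothesis so : small_overlap.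

(** The bound [3 * L] leaves more than [L] letters after trimming at most [L] at each end, so a
    block identifies its relation word. *)
Lemma block_size l b r : token_wf (Block l b r) -> L < size b.
Proof.
move=> [/so.1]; rewrite !size_cat; lia.
Qed.

(** The first [L.+1] letters of [b] lie inside [u] at offset [d] and inside [l ++ b ++ r] at offset
    [l]; uniqueness of long factors identifies the offsets. *)
Lemma aligned_prefix u z d b y l r :
  rel_word u -> rel_word (l ++ b ++ r) -> u ++ z = d ++ b ++ y ->
  size d + L < size u -> L < size b -> d = l.
Proof.
move=> ru rb e szu szb.
have eb := cat_take_drop L.+1 b.
have eu : u = d ++ take L.+1 b ++ drop (size d + L.+1) u.
  rewrite -{1}(cat_take_drop (size d + L.+1) u) catA; congr (_ ++ _).
  move/(congr1 (take (size d + L.+1))): e.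
  rewrite takel_cat ?addnS// => ->.
  by rewrite take_cat -addnS ltnNge leq_addr /= addKn takel_cat.
move: ru rb; rewrite eu -[in rel_word (l ++ _)]eb -catA => ru rb.
have [] := so.2 _ _ _ _ _ ru rb; last by [].
by rewrite size_takel.
Qed.

(** The cut falls between tokens, with [d] empty, or inside a block whose tail [d] is overlapped by
    [u]. Such a block stays on the left, trimmed by [d], so no token is added. *)
Lemma split_before_rel_word ts x u z :
  wf ts -> rel_word u -> yield ts = x ++ u ++ z ->
  exists s d t, [/\ wf s, wf t, yield s = x, u ++ z = d ++ yield t
    & size d <= L /\ size s + size t = size ts].
Proof.
move=> wts ru /split_yield [[s [t [ets es et]]]|].
  exists s, [::], t; move: wts; rewrite ets size_cat => /wf_cat[ws wt].
  by rewrite -et.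
move=> [s [l [c [d [r [t [ets ex euz nc nd]]]]]]].
have [ws wbt] : wf s /\ wf (Block l (c ++ d) r :: t).
  by apply: wf_cat; rewrite -ets.
case: (wbt) => [[rb szl szr] wt cbt].
have szu := so.1 _ ru.
have Lu : L < size u by apply: leq_ltn_trans szu; rewrite leq_pmull.
(* Otherwise the first [L.+1] letters of [d] would begin [u] and also occur at the nonzero offset
   [l ++ c] of the block's relation word. *)
have szd : size d <= L.
  rewrite leqNgt; apply/negP => szd.
  have := @aligned_prefix u z [::] d (yield t) (l ++ c) r ru.
  rewrite -!catA in rb *; move=> /(_ rb euz Lu szd).
  by case: l {wbt ets rb szl cbt} => //=; case: c nc {ex}.
(* As [u] reaches beyond [d], another token follows. If it is a block, [u] covers more than [L] of
   its letters, so [d] is exactly its trimmed left end; as [d] is non-empty, compatibility leaves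
   this block uncut on the right. *)
have r0 : nilp r.
  case: t ets wbt wt cbt euz => [|t t'] ets _ wt cbt euz.
    move/(congr1 size): euz; rewrite !size_cat addn0 => euz.
    by move: Lu; rewrite ltnNge (leq_trans _ szd)// -euz leq_addr.
  case: t ets wt cbt euz => [//|l' b' r'] _ [wb' _ _] /= cbt euz.
  have dl : d = l'.
    apply: (aligned_prefix ru (let: And3 h _ _ := wb' in h) euz).
      apply: leq_ltn_trans szu; rewrite mulSn mulSn mul1n.
      by rewrite leq_add// leq_addr.
    exact: block_size wb'.
  by case/orP: cbt => //; rewrite -dl; case: (d) nd.
have {r0} r0 : r = [::] by case: (r) r0.
exists (rcons s (Block l c d)), d, t; split=> //.
- move: wts; rewrite ets => /wf_rcons_block; apply; split=> //.
  by move: rb; rewrite r0 cats0.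
- by rewrite -cats1 yield_cat ex /yield /= cats0.
- by rewrite ets size_rcons size_cat /= addSnnS.
Qed.

(** At least one token lies entirely inside [u] and disappears. This strict loss pays for the block
    inserted in its place. *)
Lemma split_after_rel_word ts d u z :
  wf ts -> rel_word u -> size d <= L -> d ++ yield ts = u ++ z ->
  exists2 t, wf t & yield t = z /\ size t < size ts.
Proof.
move=> wts ru szd euz; have szu := so.1 _ ru.
move: szu; rewrite mulSn mulSn mul1n => szu.
have dlu : size d < size u.
  by apply: leq_ltn_trans szu; rewrite (leq_trans szd)// leq_addr.
have [u1 eu] : exists u1, u = d ++ u1.
  exists (drop (size d) u).
  rewrite -{1}(cat_take_drop (size d) u); congr (_ ++ _).
  by move/(congr1 (take (size d))): euz; rewrite take_size_cat// takel_cat// ltnW.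
move: euz; rewrite eu -catA => /(congr1 (drop (size d))).
rewrite !drop_size_cat// => /split_yield [[s [t [ets es et]]]|].
  exists t; first by move: wts; rewrite ets => /wf_cat[].
  split=> //; rewrite ets size_cat; case: s {ets} es => [e|*].
    by move: dlu; rewrite eu -e cats0 ltnn.
  by rewrite /= addSn ltnS leq_addl.
move=> [s [l [c [e [r [t [ets eu1 ez nc ne]]]]]]].
have [ws wbt] : wf s /\ wf (Block l (c ++ e) r :: t).
  by apply: wf_cat; rewrite -ets.
case: (wbt) => [[rb szl szr] wt cbt].
have szc : size c <= L.
  rewrite leqNgt; apply/negP => szc.
  have h1 : rel_word ((d ++ yield s) ++ c ++ [::]).
    by rewrite cats0 -catA -eu1 -eu.
  have h2 : rel_word (l ++ c ++ (e ++ r)) by move: rb; rewrite -!catA.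
  by have [_] := so.2 _ _ _ _ _ h1 h2 szc; case: (e) ne.
(* The pieces [d] and [c] have at most [L] letters each, while [u] has more than [3 * L], so some
   whole token lies between them. *)
have [s' [t' es]] : exists s' t', s = rcons s' t'.
  case: (lastP s) eu1 => [|s' t' _]; last by exists s', t'.
  move=> /= eu1; move: szu; rewrite eu eu1 size_cat ltnNge.
  by rewrite leq_add // (leq_trans szc) // leq_addr.
(* If the preceding token is a block, it lies inside [u], so [u] is its relation word and [c] is its
   trimmed right end. This is non-empty, so compatibility forces [l] to be empty. *)
have l0 : l = [::].
  have ct : compatible t' (Block l (c ++ e) r).
    move: wts; rewrite ets es cat_rcons => /wf_cat[_ [_ _]]; exact.
  case: t' es ct => [a es|l' b' r' es]; first by case: (l).
  rewrite /compatible.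
  have wb' : token_wf (Block l' b' r').
    by move: ws; rewrite es -cats1 => /wf_cat[_ []].
  have h1 : rel_word ((d ++ yield s') ++ b' ++ c).
    move: ru; rewrite eu eu1 es -cats1 yield_cat /yield /= cats0.
    by rewrite -!catA.
  have [_ <-] := so.2 _ _ _ _ _ h1 (let: And3 h _ _ := wb' in h) (block_size wb').
  by case: (c) nc => //; case: (l).
exists (Block c e r :: t).
  by split=> //; split; [move: rb; rewrite l0 -catA|..].
split; first by rewrite ez.
by rewrite ets size_cat es size_rcons /= addSn ltnS leq_addl.
Qed.

Lemma rewrite_step ts x u v z :
  wf ts -> rel_word u -> rel_word v -> yield ts = x ++ u ++ z ->
  exists2 ts', wf ts' & yield ts' = x ++ v ++ z /\ size ts' <= size ts.
Proof.
move=> wts ru rv /(split_before_rel_word wts ru)[s [d [t]]].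
move=> [ws wt es /esym /(split_after_rel_word wt ru) h [/h[t' wt' [et' szt']] <-]].
exists (s ++ Block [::] v [::] :: t').
  by apply: wf_cat_cons; [exact: wf_rcons_uncut|exact: wf_uncut_cons].
by rewrite yield_cat yield_cons es et' size_cat leq_add2l.
Qed.

End SmallOverlap.

(** * Length bound within a congruence class *)

Section FiniteClasses.
Variables (A : Type) (rel_word : seq A -> Prop) (L : nat).
Hypothesis so : small_overlap rel_word L.

(** Quantifying over the contexts [p] and [q] makes this preorder compatible with concatenation, so
    its symmetric part is a congruence. *)
Definition token_le (x y : seq A) :=
  forall p q ts, wf rel_word L ts -> yield ts = p ++ x ++ q ->
  exists2 ts', wf rel_word L ts' & yield ts' = p ++ y ++ q /\ size ts' <= size ts.

Lemma gen_congruence_token_le (T : semigroupType) (f : T -> seq A)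
    (rels : set (T * T)) :
    {morph f : x y / (x * y)%g >-> x ++ y} ->
    (forall r, rels r -> rel_word (f r.1) /\ rel_word (f r.2)) ->
  forall x y, gen_congruence rels (x, y) -> token_le (f x) (f y).
Proof.
move=> fM frels x y.
pose E : set (T * T) := [set r : T * T |
  token_le (f r.1) (f r.2) /\ token_le (f r.2) (f r.1)].
suff cE : congruence E /\ (rels `<=` E) by move/(_ E cE) => /= -[].
have trans u v w : token_le u v -> token_le v w -> token_le u w.
  move=> uv vw p q ts wts /uv-/(_ wts) [ts' wts' [/vw-/(_ wts') [ts'' ? [? le2]] le1]].
  by exists ts'' => //; split=> //; apply: leq_trans le1.
have mul u u' v v' : token_le u u' -> token_le v v' -> token_le (u ++ v) (u' ++ v').
  move=> uu' vv'; apply: (trans _ (u' ++ v)) => p q ts wts; rewrite -!catA.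
    exact: uu'.
  by rewrite catA => /vv' -/(_ wts)[ts' ? []]; rewrite -!catA; exists ts'.
have refl u : token_le u u by move=> p q ts; exists ts.
split; last first.
  move=> r /frels[r1 r2].
  by split=> p q ts wts ets; apply: (rewrite_step so wts _ _ ets).
split=> //=.
- by move=> ? ? [].
- by move=> u v w [? ?] [? ?]; split; apply: trans; eassumption.
- by move=> u u' v v' [? ?] [? ?]; rewrite /E /= !fM; split; apply: mul.
Qed.

Lemma size_yield_le K ts : 0 < K -> (forall u, rel_word u -> size u <= K) ->
  wf rel_word L ts -> size (yield ts) <= size ts * K.
Proof.
move=> K0 hK; elim: ts => //= t ts IH [wt wts _].
rewrite yield_cons size_cat mulSn leq_add ?IH//.
by case: t wt => //= l b r [/hK]; rewrite !size_cat; lia.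
Qed.

(** Start from [x] decomposed into single letters: [y] then needs at most [size x] tokens, each of
    length at most [K]. *)
Lemma token_le_size K x y : 0 < K -> (forall u, rel_word u -> size u <= K) ->
  token_le x y -> size y <= size x * K.
Proof.
move=> K0 hK /(_ [::] [::] (map (@Letter A) x)) [].
- elim: x => //= a [|b x] IH; split=> //.
- by rewrite cats0 /yield -map_comp /=; elim: x => //= a x ->.
move=> ts wts []; rewrite cats0 size_map /= => <- le.
apply: leq_trans (size_yield_le K0 hK wts) _.
by rewrite leq_pmul2r.
Qed.

End FiniteClasses.

(** * Consequences of a superadditive size on a semigroup *)

Section SuperadditiveSize.
Variables (S : semigroupType) (mu : S -> nat).
Hypothesis muM : forall x y, mu x + mu y <= mu (x * y)%g.
Hypothesis mu0 : forall x, mu x = 0 -> is_identity x.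

(** Multiplying by [s] changes nothing if [mu s = 0] and strictly raises [mu] otherwise. Hence the
    principal ideal of [a] contains, besides [a], only elements of larger [mu]. *)
Lemma superadditive_J_trivial : J_trivial S.
Proof.
have above a : (principal_ideal a `<=` [set b | b = a \/ mu a < mu b]).
  apply: smallest_sub => [|b -> /=]; last by left.
  move=> x s /= xa; have [s0|s0] := posnP (mu s).
    by have [-> ->] := mu0 s0 x.
  by have := muM s x; have := muM x s; case: xa => [->|?]; split; right; lia.
move=> a b ab.
have : principal_ideal a b by rewrite ab; apply: sub_gen_smallest.
have : principal_ideal b a by rewrite -ab; apply: sub_gen_smallest.
by move=> /above /= [->//|ba] /above /= [->//|]; move: ba; lia.
Qed.

(** If [mu a] is positive, [mu] is unbounded on the powers of [a], so these are infinitely many. *)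
Lemma superadditive_torsion_free : torsion_free S.
Proof.
move=> a; rewrite /torsion; set T := smallest _ _ => finT.
have Ta : T a by apply: sub_gen_smallest.
have TM x : T x -> T (x * a)%g.
  by move=> Tx E hE; case: (hE) => sE _; apply: sE; [exact: Tx|exact: Ta].
have [B hB] : exists B, forall x, T x -> mu x <= B.
  have /finite_fsetP[X eX] : finite_set (mu @` T) by exact: finite_image finT.
  exists (\max_(i <- X) i) => x Tx.
  apply: (@leq_bigmax_seq _ _ xpredT id) => //.
  have : (mu @` T) (mu x) by exists x.
  by rewrite eX.
apply: mu0; apply/eqP; rewrite -leqn0 leqNgt; apply/negP => a0.
suff : forall n, exists2 x, T x & n <= mu x.
  by move=> /(_ B.+1)[x /hB]; lia.
elim=> [|n [x Tx nx]]; first by exists a.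
by exists (x * a)%g; [exact: TM|have := muM x a; lia].
Qed.

Lemma superadditive_properties (x : S) : 0 < mu x ->
  [/\ nontrivial S, torsion_free S & J_trivial S] /\
  [/\ ~ is_group S, ~ is_inverse S & ~ is_regular S].
Proof.
(* From [x * y * x = x] superadditivity would give [2 * mu x + mu y <= mu x]. Groups and inverse
   semigroups are excluded as well, being regular. *)
move=> x0; have nreg : ~ is_regular S.
  move=> /(_ x)[y xyx]; have := muM (x * y)%g x; have := muM x y; rewrite xyx; lia.
split; split=> //.
- by exists x, (x * x)%g => xx; have := muM x x; rewrite -xx; lia.
- exact: superadditive_torsion_free.
- exact: superadditive_J_trivial.
- move=> [e ide inv]; apply: nreg => y; have [z [yz _]] := inv y.
  by exists z; rewrite yz (ide y).1.
- by move=> inv; apply: nreg => y; have [z [[yzy _] _]] := inv y; exists z.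
Qed.

End SuperadditiveSize.

(** * The maximal length of a representative *)

Section QuotientSize.
Variables (T : semigroupType) (rels : set (T * T)) (len : T -> nat) (K : nat).
Hypothesis lenM : {morph len : x y / (x * y)%g >-> x + y}.
Hypothesis len_bound :
  forall x y, gen_congruence rels (x, y) -> len y <= len x * K.
Local Open Scope quotient_scope.

(** Comparison with [repr a] bounds the lengths in the class [a], so a maximum exists. The product
    of two longest representatives represents the product of the classes. *)
Lemma exists_superadditive_size : exists mu : cquot rels -> nat,
  (forall a b, mu a + mu b <= mu (a * b)%g) /\
  (forall x, len x <= mu (\pi_(cquot rels) x)).
Proof.
pose P (a : cquot rels) n := `[< exists2 x, \pi_(cquot rels) x = a & len x = n >].
have exP a : exists n, P a n.
  by exists (len (repr a)); apply/asboolP; exists (repr a) => //; rewrite reprK.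
have ubP a n : P a n -> n <= len (repr a) * K.
  move=> /asboolP[x xa <-]; apply: len_bound; apply/cquot_eqP.
  by rewrite reprK xa.
exists (fun a => ex_maxn (exP a) (@ubP a)); split=> [a b|x]; last first.
  by case: ex_maxnP => n _; apply; apply/asboolP; exists x.
case: ex_maxnP => m /asboolP[x xa xm] _.
case: ex_maxnP => n /asboolP[y yb yn] _.
case: ex_maxnP => p _; apply; apply/asboolP; exists (x * y)%g.
  by rewrite -xa -yb -(cquot_piM rels x y).
by rewrite lenM xm yn.
Qed.

End QuotientSize.

(** * Small overlap implies the algebraic properties *)

Section Presented.
Variables (A : finType) (k : nat) (a0 : A).

Lemma presented_monoid_properties (p : monoid_presentation A k) L :
  small_overlap (fun u => exists2 r, r \in (p : seq (word A * word A)) &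
    u = r.1 \/ u = r.2) L ->
  let M := presented_monoid p in
  [/\ nontrivial M, torsion_free M & J_trivial M] /\
  [/\ ~ is_group M, ~ is_inverse M & ~ is_regular M].
Proof.
set rw := fun u => _; move=> so M.
(* The successor keeps [K] positive, as single-letter tokens require. *)
pose K := (presentation_size (fun w : word A => size w) MaxLength p).+1.
have hK u : rw u -> size u <= K.
  move=> [r rp ur].
  have [r1 r2] := presentation_size_ge (fun w : word A => size w) MaxLength rp.
  by case: ur => ->; apply: leqW.
have bnd x y : gen_congruence [set r | r \in (p : seq (word A * word A))] (x, y) ->
    size y <= size x * K.
  move=> xy; apply: (@token_le_size _ rw L) => //.
  apply: (gen_congruence_token_le so _ _ xy) => // r rp.
  by split; exists r => //; [left|right].
have sizeM : {morph (fun w : word A => size w) : x y / (x * y)%g >-> x + y}.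
  exact: size_cat.
have [mu [muM mul]] := exists_superadditive_size sizeM bnd.
apply: (@superadditive_properties M mu muM) (\pi_M%qT [:: a0]) _.
  (* Size zero forces the chosen representative to be the empty word. *)
  move=> x x0; have := mul (repr x); rewrite reprK x0 leqn0 size_eq0 => /eqP rx.
  rewrite -[x]reprK rx => y.
  exact: (conj (@mul1g M y) (@mulg1 M y)).
exact: (leq_trans _ (mul [:: a0])).
Qed.

Lemma presented_semigroup_properties (p : semigroup_presentation A k) L :
  small_overlap (fun u => exists2 r, r \in (p : seq (neword A * neword A)) &
    u = neword_val r.1 \/ u = neword_val r.2) L ->
  let S := presented_semigroup p in
  [/\ nontrivial S, torsion_free S & J_trivial S] /\
  [/\ ~ is_group S, ~ is_inverse S & ~ is_regular S].
Proof.
set rw := fun u => _; move=> so S.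
pose K := (presentation_size (fun w : neword A => size (neword_val w)) MaxLength p).+1.
have hK u : rw u -> size u <= K.
  move=> [r rp ur].
  have [r1 r2] := presentation_size_ge (fun w : neword A => size (neword_val w)) MaxLength rp.
  by case: ur => ->; apply: leqW.
have bnd x y : gen_congruence [set r | r \in (p : seq (neword A * neword A))] (x, y) ->
    size (neword_val y) <= size (neword_val x) * K.
  move=> xy; apply: (@token_le_size _ rw L) => //.
  apply: (gen_congruence_token_le so _ _ xy) => // r rp.
  by split; exists r => //; [left|right].
have sizeM :
    {morph (fun w : neword A => size (neword_val w)) : x y / (x * y)%g >-> x + y}.
  by move=> x y; apply: size_cat.
have [mu [muM mul]] := exists_superadditive_size sizeM bnd.
(* Words are non-empty here, so size zero never occurs and the condition on such elements is
   vacuous. *)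
have mu_gt0 x : 0 < mu x.
  have := mul (repr x); rewrite reprK; apply: leq_trans.
  by rewrite lt0n size_eq0 neword_neq0.
apply: (@superadditive_properties S mu muM) (\pi_S%qT (@NEWord A [:: a0] isT)) _ => //.
by move=> x x0; have := mu_gt0 x; rewrite x0.
Qed.

End Presented.

(** * Counting inequalities *)

Section Counting.
Variable T : eqType.
Implicit Types (s : seq T) (P : pred T).

(** The pairs [(w, b)] with [w] satisfying [P] have distinct images in [s]. *)
Lemma count_leq_inj (B : finType) s P (f : T -> B -> T) : uniq s ->
  (forall w b, w \in s -> P w -> f w b \in s) ->
  (forall w b w' b', P w -> P w' -> f w b = f w' b' -> w = w' /\ b = b') ->
  count P s * #|B| <= size s.
Proof.
move=> us fs finj.
have -> : count P s * #|B| = size [seq f w b | w <- [seq w <- s | P w], b <- enum B].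
  by rewrite size_allpairs size_filter cardE.
apply: uniq_leq_size.
  apply: allpairs_uniq; [exact: filter_uniq|exact: enum_uniq|].
  move=> [w b] [w' b'] /= /allpairsP[[w1 b1] /= [+ _ [-> _]]].
  rewrite mem_filter => /andP[Pw _].
  move=> /allpairsP[[w2 b2] /= [+ _ [-> _]]].
  by rewrite mem_filter => /andP[Pw' _] /finj[]// -> ->.
move=> _ /allpairsP[[w b] /= [+ _ ->]].
by rewrite mem_filter => /andP[Pw ws]; apply: fs.
Qed.

(** A union bound: each of the [#|J|] events has proportion at most [1 / (D * #|J|)]. *)
Lemma count_cover (J : finType) D s P (Q : J -> pred T) :
  (forall w, w \in s -> P w -> exists j, Q j w) ->
  (forall j, count (Q j) s * (D * #|J|) <= size s) ->
  count P s * D <= size s.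
Proof.
move=> PQ cQ.
have le : count P s <= \sum_j count (Q j) s.
  have -> : \sum_j count (Q j) s = \sum_(w <- s) \sum_j Q j w.
    rewrite exchange_big; apply: eq_bigr => j _.
    by rewrite -sum1_count big_mkcond.
  rewrite -sum1_count big_mkcond big_seq [leqRHS]big_seq.
  apply: leq_sum => w ws; case: ifP => // /(PQ _ ws)[j Qj].
  by rewrite (bigD1 j)//= Qj.
have [J0|J0] := posnP #|J|.
  suff -> : count P s = 0 by [].
  by apply/eqP; rewrite -leqn0 (leq_trans le)// big_pred0// => j; have := fintype0 j.
rewrite -(leq_pmul2r J0) -mulnA; apply: leq_trans (leq_mul le (leqnn _)) _.
by rewrite big_distrl /= -[leqRHS]mulnC -sum_nat_const; apply: leq_sum => j _.
Qed.

End Counting.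

Lemma leq_mul_sqr_exp2 b x : 27 * b <= x -> b * x ^ 2 <= 2 ^ x.
Proof.
move=> bx.
have h : x ^ 3 <= 27 * 2 ^ x.
  (* Cubing [y <= 2 ^ (x %/ 3)] and using [x <= 3 * y] produces the constant 27. *)
  pose y := (x %/ 3).+1.
  have xy : x <= 3 * y by rewrite /y; lia.
  have y2 : y <= 2 ^ (x %/ 3) by exact: ltn_expl.
  have e : (2 ^ (x %/ 3)) ^ 3 <= 2 ^ x by rewrite -expnM leq_exp2l//; lia.
  have y3 : y ^ 3 <= 2 ^ x by apply: leq_trans e; rewrite leq_exp2r.
  apply: leq_trans (_ : (3 * y) ^ 3 <= _); first by rewrite leq_exp2r.
  by rewrite expnMn leq_mul.
rewrite -(leq_pmul2l (isT : 0 < 27)) mulnA; apply: leq_trans h.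
by rewrite [x ^ 3]expnS leq_mul2r bx orbT.
Qed.

(** * Families of words without small overlap are rare *)

Section Words.
Variables (A I : finType).
Implicit Types (w : {ffun I -> seq A}) (st : stratification).

Definition total_size st w :=
  match st with
  | SumLength => \sum_i size (w i)
  | MaxLength => \max_i size (w i)
  end.

(** The flag [e] is set for semigroup presentations, where empty words are excluded. *)
Definition in_stratum (e : bool) st (n : nat) w :=
  [forall i, e ==> (0 < size (w i))] && (total_size st w == n).

Definition small_overlap_family L w := small_overlap (fun u => exists i, u = w i) L.

(** For [i = j] the second occurrence starts later, so after overwriting it the original can be
    recovered from left to right. *)
Definition repeated l i x j y w :=
  [&& (i != j) || (x < y), x + l <= size (w i), y + l <= size (w j)
    & take l (drop x (w i)) == take l (drop y (w j))].

Lemma size_le_total st w i : size (w i) <= total_size st w.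
Proof.
case: st => /=; first by rewrite (bigD1 i)//= leq_addr.
exact: (leq_bigmax i).
Qed.

Lemma exists_long st w : 0 < #|I| -> exists j, total_size st w <= size (w j) * #|I|.
Proof.
move=> I0; have [j ej] := eq_bigmax (fun i => size (w i)) I0.
exists j; case: st => /=; last by rewrite ej leq_pmulr.
rewrite mulnC -sum_nat_const; apply: leq_sum => i _.
by rewrite -ej leq_bigmax.
Qed.

Lemma not_small_overlap_family L w : ~ small_overlap_family L w ->
  (exists i, size (w i) <= 3 * L) \/
  (exists i x j y, repeated L.+1 i x j y w).
Proof.
move=> nsep; apply: contrapT => /not_orP[h1 h2]; apply: nsep; split.
  by move=> _ [i ->]; rewrite ltnNge; apply/negP => ?; apply: h1; exists i.
move=> p f q p' q' [i ei] [j ej] Lf.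
have rep i' p1 q1 j' p2 q2 : p1 ++ f ++ q1 = w i' -> p2 ++ f ++ q2 = w j' ->
    (i' != j') || (size p1 < size p2) ->
    repeated L.+1 i' (size p1) j' (size p2) w.
  move=> e1 e2 ij; rewrite /repeated ij -e1 -e2 !drop_size_cat// !size_cat.
  by rewrite !takel_cat// eqxx andbT /= !leq_add2l; apply/andP; split; lia.
have nrep i' p1 q1 j' p2 q2 : p1 ++ f ++ q1 = w i' -> p2 ++ f ++ q2 = w j' ->
    ~~ ((i' != j') || (size p1 < size p2)).
  move=> e1 e2; apply/negP => /(rep _ _ _ _ _ _ e1 e2) r; apply: h2.
  by exists i', (size p1), j', (size p2).
(* Using both orders of the two occurrences leaves only equal indices and equal offsets. *)
have := nrep _ _ _ _ _ _ ei ej; have := nrep _ _ _ _ _ _ ej ei.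
rewrite !negb_or !negbK -!leqNgt => /andP[/eqP eij le1] /andP[_ le2].
have sz : size p = size p' by apply/eqP; rewrite eqn_leq le1 le2.
move: ei; rewrite -eij -ej => /eqP; rewrite eqseq_cat// => /andP[/eqP ->].
by rewrite eqseq_cat// eqxx /= => /eqP ->.
Qed.

(* Lengthening by a multiple of [K.+1] lets one read off both [s] and the old
   [w i] from the result when [size (w i) <= K]. *)
Definition lengthen st K i j w s : {ffun I -> seq A} :=
  [ffun x => if x == i then w i ++ take (s * K.+1) (w j)
    else if x == j then
      (if st is SumLength then drop (s * K.+1) (w j) else w j)
    else w x].

(** Moving letters preserves the sum. For the maximum the letters are copied: word [j] is unchanged
    and word [i] stays shorter than it. *)
Lemma lengthen_stratum e st n M K i j w s : i != j -> s < M ->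
  size (w i) <= K -> M * K.+1 < size (w j) ->
  in_stratum e st n w -> in_stratum e st n (lengthen st K i j w s).
Proof.
move=> ij sM szi szj /andP[/forallP pos /eqP tot].
have sK : s * K.+1 + K < size (w j).
  apply: leq_ltn_trans szj; apply: leq_trans (_ : s.+1 * K.+1 <= _).
    by rewrite mulSn; lia.
  by rewrite leq_mul2r sM orbT.
have ji : (j == i) = false by rewrite eq_sym (negbTE ij).
have szfi : size (lengthen st K i j w s i) = size (w i) + s * K.+1.
  by rewrite ffunE eqxx size_cat size_takel//; lia.
have fx x : x != i -> x != j -> lengthen st K i j w s x = w x.
  by rewrite ffunE => /negbTE -> /negbTE ->.
apply/andP; split.
  apply/forallP => x; apply/implyP => et; have := implyP (pos x) et.
  have [->|xi] := eqVneq x i; first by rewrite szfi; lia.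
  have [->|xj] := eqVneq x j; last by rewrite fx.
  rewrite ffunE ji eqxx => _; case: (st); last by lia.
  by rewrite size_drop; lia.
apply/eqP; rewrite -tot; case: st szfi fx {tot} => szfi fx /=.
  have szfj : size (lengthen SumLength K i j w s j) = size (w j) - s * K.+1.
    by rewrite ffunE ji eqxx size_drop.
  have split_sum (F : I -> nat) :
      \sum_x F x = F i + (F j + \sum_(x | (x != i) && (x != j)) F x).
    by rewrite (bigD1 i)//= (bigD1 j) //= eq_sym.
  rewrite !split_sum szfi szfj.
  rewrite [X in _ + (_ + X)](eq_bigr (fun x => size (w x))).
    by move: sK; move: (\sum_(x | _) _) (s * K.+1) => S t; lia.
  by move=> x /andP[? ?]; rewrite fx.
have fj : lengthen MaxLength K i j w s j = w j by rewrite ffunE ji eqxx.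
apply/eqP; rewrite eqn_leq; apply/andP; split; apply/bigmax_leqP => x _.
  have [->|xi] := eqVneq x i.
    rewrite szfi; apply: leq_trans (leq_bigmax j); lia.
  by have [->|xj] := eqVneq x j; rewrite ?fj ?fx//;
    apply: (leq_bigmax (F := fun x => size (w x))).
have [->|xi] := eqVneq x i.
  apply: leq_trans (leq_bigmax j); rewrite fj; lia.
by apply: leq_trans (leq_bigmax x); have [->|xj] := eqVneq x j; rewrite ?fj ?fx.
Qed.

Lemma lengthen_inj st M K i j w w' s s' : i != j -> s < M -> s' < M ->
  size (w i) <= K -> M * K.+1 < size (w j) ->
  size (w' i) <= K -> M * K.+1 < size (w' j) ->
  lengthen st K i j w s = lengthen st K i j w' s' -> w = w' /\ s = s'.
Proof.
move=> ij sM sM' szi szj szi' szj' /ffunP ef.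
have lt t v : t < M -> M * K.+1 < v -> t * K.+1 <= v.
  move=> tM Mv; apply: leq_trans (ltnW Mv); rewrite leq_mul2r; lia.
have ji : (j == i) = false by rewrite eq_sym (negbTE ij).
have ei := ef i; rewrite !ffunE eqxx in ei.
have szeq : size (w i) + s * K.+1 = size (w' i) + s' * K.+1.
  by move/(congr1 size): ei; rewrite !size_cat !size_takel// lt.
have es : s = s'.
  move/(congr1 (fun m => m %/ K.+1)): szeq.
  by rewrite ![_ + _ * K.+1]addnC !divnMDl// !divn_small ?ltnS// !addn0.
move: szeq; rewrite es => /addIn szeq; split=> //.
move/eqP: ei; rewrite es eqseq_cat// => /andP[/eqP wi /eqP tk].
(* The prefix taken from [w j] is visible in the new word [i]; for the sum length the remaining
   suffix is what stands at [j]. *)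
have wj : w j = w' j.
  have ej := ef j; rewrite !ffunE ji eqxx es in ej.
  case: st {ef} ej => // dr.
  by rewrite -(cat_take_drop (s' * K.+1) (w j)) tk dr cat_take_drop.
apply/ffunP => x; have [->//|xi] := eqVneq x i; have [->//|xj] := eqVneq x j.
by have := ef x; rewrite !ffunE (negbTE xi) (negbTE xj).
Qed.

Definition replace l j y w (v : l.-tuple A) : {ffun I -> seq A} :=
  [ffun x => if x == j then take y (w j) ++ v ++ drop (y + l) (w j) else w x].

Lemma size_replace l j y w (v : l.-tuple A) x : y + l <= size (w j) ->
  size (replace j y w v x) = size (w x).
Proof.
move=> yl; rewrite ffunE; case: eqP => [->|//].
by rewrite !size_cat size_takel ?size_tuple ?size_drop; lia.
Qed.

Lemma replace_stratum e st n l j y w (v : l.-tuple A) : y + l <= size (w j) ->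
  in_stratum e st n w -> in_stratum e st n (replace j y w v).
Proof.
move=> yl; rewrite /in_stratum; congr (_ && (_ == n)).
  by apply: eq_forallb => x; rewrite size_replace.
by case: st => /=; apply: eq_bigr => x _; rewrite size_replace.
Qed.

(* When the two occurrences overlap, the letters of the second one are
   determined successively, each by a letter lying [size p - x] places earlier. *)
Lemma shifted_factor_inj (p q f f' : seq A) x :
  size f = size f' -> x < size p ->
  take (size f) (drop x (p ++ f ++ q)) = f ->
  take (size f') (drop x (p ++ f' ++ q)) = f' -> f = f'.
Proof.
move=> sz xp ef ef'.
case: f sz ef => [|a f0] sz ef; first by case: f' sz {ef'}.
move: sz ef ef'; set f := a :: f0 => sz ef ef'.
apply: (@eq_from_nth _ a) => // t.
elim/ltn_ind: t => t IH tf.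
have -> : nth a f t = nth a (p ++ f ++ q) (x + t).
  by rewrite -{1}ef nth_take// nth_drop.
have -> : nth a f' t = nth a (p ++ f' ++ q) (x + t).
  by rewrite -{1}ef' nth_take -?sz// nth_drop.
rewrite !nth_cat.
case: ltnP => // pxt; case: ltnP => h; first by rewrite -sz h IH//; lia.
lia.
Qed.

(** The overwritten factor equals the one in word [i], which is untouched if [i] differs from [j].
    Otherwise the two may overlap, and [shifted_factor_inj] recovers it. *)
Lemma replace_inj l i x j y w w' (v v' : l.-tuple A) :
  repeated l i x j y w -> repeated l i x j y w' ->
  replace j y w v = replace j y w' v' -> w = w' /\ v = v'.
Proof.
move=> /and4P[ij xi yj /eqP e] /and4P[_ xi' yj' /eqP e'] /ffunP ef.
have ej := ef j; rewrite !ffunE eqxx in ej.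
move/eqP: ej; rewrite eqseq_cat; last by rewrite !size_takel// (leq_trans (leq_addr l y)).
move=> /andP[/eqP tk]; rewrite eqseq_cat ?size_tuple// => /andP[/eqP ev /eqP dr].
split; last exact: val_inj.
have wne z : z != j -> w z = w' z by move=> zj; have := ef z; rewrite !ffunE (negbTE zj).
have dec (u : seq A) : u = take y u ++ take l (drop y u) ++ drop (y + l) u.
  by rewrite addnC -drop_drop !cat_take_drop.
suff eqf : take l (drop y (w j)) = take l (drop y (w' j)).
  apply/ffunP => z; have [->|/wne//] := eqVneq z j.
  by rewrite (dec (w j)) (dec (w' j)) tk eqf dr.
have [eij|nij] := eqVneq i j; last by rewrite -e -e' (wne _ nij).
move: ij e e' xi xi'; rewrite eij eqxx /= => xy e e' _ _.
have szf : size (take l (drop y (w j))) = l by rewrite size_takel// size_drop; lia.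
have szf' : size (take l (drop y (w' j))) = l by rewrite size_takel// size_drop; lia.
apply: (@shifted_factor_inj (take y (w j)) (drop (y + l) (w j)) _ _ x).
- by rewrite szf szf'.
- by rewrite size_takel//; lia.
- by rewrite szf -dec.
- by rewrite szf' tk dr -dec.
Qed.

Lemma count_not_small_overlap_family e st C : 1 < #|A| -> 0 < #|I| ->
  exists N, forall n, N <= n -> exists L, forall s, uniq s ->
    (forall w, (w \in s) = in_stratum e st n w) ->
    count (fun w => ~~ `[< small_overlap_family L w >]) s * C <= size s.
Proof.
move=> A2 I0; have [->|C0] := posnP C.
  by exists 0 => n _; exists 0 => s _ _; rewrite muln0.
(* [M] is [2 * C] for each pair of indices, as each of the two kinds of failure may take a
   proportion [1 / (2 * C)]. [D] makes [L = n %/ D] so small that a longest word, of length at least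
   [n / c], exceeds [M * (3 * L).+1]. *)
pose c := #|I|; pose M := 2 * C * (c * c); pose D := (6 * c * M).+1.
have M0 : 0 < M by rewrite !muln_gt0 C0 I0.
(* The second failure needs [M * n.+1 ^ 2] choices; since [n < D * L.+1], this is at most
   [b * L.+1 ^ 2], hence at most [2 ^ L.+1] for large [n]. *)
pose b := M * D ^ 2.
exists (2 * c * M + D * (27 * b)).+1 => n nN.
pose L := n %/ D; exists L => s us hs.
have DL : D * L <= n by rewrite mulnC leq_trunc_div.
have nD : n < D * L.+1 by rewrite mulnC ltn_ceil.
have bL : 27 * b <= L by rewrite leq_divRL// mulnC; lia.
have long_partner w : w \in s -> forall i, size (w i) <= 3 * L ->
    exists j, (i != j) && (M * (3 * L).+1 < size (w j)).
  rewrite hs => /andP[_ /eqP tot] i szi.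
  have [j] := exists_long st w I0; rewrite tot -/c => nj; exists j.
  have Mj : c * (M * (3 * L).+1) < n.
    have : 6 * c * M * L <= n by apply: leq_trans DL; rewrite leq_mul2r leqnSn orbT.
    have : 2 * c * M < n by lia.
    have -> : c * (M * (3 * L).+1) = 3 * (c * M * L) + c * M by lia.
    have -> : 6 * c * M * L = 6 * (c * M * L) by lia.
    have -> : 2 * c * M = 2 * (c * M) by lia.
    lia.
  have {}Mj : M * (3 * L).+1 < size (w j).
    by rewrite -(ltn_pmul2l I0); apply: leq_trans Mj _; rewrite mulnC.
  rewrite Mj andbT; apply/eqP => ij; move: szi Mj; rewrite ij => szi.
  by rewrite ltnNge (leq_trans szi)// (leq_trans (leqnSn _))// leq_pmull.
(* Short relation word: the [M] ways of lengthening it, over all pairs of indices. *)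
have h1 : count (fun w => [exists i, size (w i) <= 3 * L]) s * (2 * C) <= size s.
  apply: (@count_cover _ (I * I)%type (2 * C) s _ (fun ij w =>
    [&& ij.1 != ij.2, size (w ij.1) <= 3 * L & M * (3 * L).+1 < size (w ij.2)])).
    move=> w ws /existsP[i szi]; have [j /andP[ij szj]] := long_partner w ws i szi.
    by exists (i, j); rewrite /= ij szi szj.
  move=> [i j]; rewrite card_prod -/c -/M -[X in _ * X]card_ord.
  apply: (@count_leq_inj _ 'I_M _ _ (fun w t => lengthen st (3 * L) i j w t)) => //=.
    by move=> w t; rewrite !hs => ws /and3P[ij szi szj]; exact: lengthen_stratum szj ws.
  move=> w t w' t' /and3P[ij szi szj] /and3P[_ szi' szj'].
  move=> /(lengthen_inj ij (ltn_ord t) (ltn_ord t') szi szj szi' szj') [-> ?].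
  by split=> //; apply: val_inj.
(* Repeated factor: the [#|A| ^ L.+1] ways of overwriting its second occurrence, over all indices
   and positions. *)
have h2 : count (fun w => [exists i : I, exists x : 'I_n.+1, exists j : I,
    exists y : 'I_n.+1, repeated L.+1 i x j y w]) s * (2 * C) <= size s.
  apply: (@count_cover _ ((I * 'I_n.+1) * (I * 'I_n.+1))%type (2 * C) s _ (fun p w =>
    repeated L.+1 p.1.1 p.1.2 p.2.1 p.2.2 w)).
    move=> w _ /existsP[i /existsP[x /existsP[j /existsP[y r]]]].
    by exists ((i, x), (j, y)).
  move=> [[i x] [j y]] /=; rewrite !card_prod card_ord -/c.
  apply: leq_trans (_ : count (repeated L.+1 i x j y) s * #|{: L.+1.-tuple A}| <= _).
    rewrite leq_mul2l; apply/orP; right; rewrite card_tuple.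
    apply: leq_trans (_ : 2 ^ L.+1 <= _); last by rewrite leq_exp2r.
    apply: leq_trans (leq_mul_sqr_exp2 (leqW bL)).
    rewrite /b -(mulnA M) -expnMn.
    have -> : 2 * C * (c * n.+1 * (c * n.+1)) = M * n.+1 ^ 2.
      by rewrite /M (mulnACA c) -(mulnA (2 * C)) mulnn.
    by rewrite leq_mul2l leq_exp2r// nD orbT.
  apply: (@count_leq_inj _ (L.+1.-tuple A) _ _ (fun w v => replace j y w v)) => //.
    by move=> w v; rewrite !hs => ws /and4P[_ _ yj _]; exact: replace_stratum.
  by move=> w v w' v' r r'; exact: replace_inj r r'.
apply: leq_trans (_ : (count (fun w => [exists i, size (w i) <= 3 * L]) s +
  count (fun w => [exists i : I, exists x : 'I_n.+1, exists j : I,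
    exists y : 'I_n.+1, repeated L.+1 i x j y w]) s) * C <= _); last by lia.
rewrite leq_mul2r -count_predUI; apply/orP; right.
apply: leq_trans (leq_addr _ _).
rewrite -!size_filter; apply: uniq_leq_size; first exact: filter_uniq.
move=> w; rewrite !mem_filter => /andP[/asboolPn ns ws]; rewrite ws andbT.
apply/orP; case: (not_small_overlap_family ns) => [[i szi]|[i [x [j [y r]]]]]; [left|right].
  by apply/existsP; exists i.
move: ws; rewrite hs => /andP[_ /eqP tot].
case/and4P: (r) => _ xi yj _.
have le_n z t : t + L.+1 <= size (w z) -> t < n.+1.
  move=> h; rewrite ltnS -tot; apply: leq_trans (size_le_total st w z).
  exact: leq_trans (leq_addr _ _) h.
by apply/existsP; exists i; apply/existsP; exists (Ordinal (le_n _ _ xi));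
  apply/existsP; exists j; apply/existsP; exists (Ordinal (le_n _ _ yj)).
Qed.

End Words.

(** * From proportions to genericity *)

Section Generic.
Variables (R : realType) (P : choiceType) (strat : nat -> set P) (X : set P).
Hypothesis strat_finite : forall n, finite_set (strat n).
Import Order.TTheory GRing.Theory Num.Theory numFieldNormedType.Exports.
Local Open Scope ring_scope.

(** The complement has proportion at most [1 / C] eventually, for every [C]. Non-emptiness of the
    strata rules out the conventional quotient 0. *)
Lemma generic_of_count :
  (exists N, forall n, (N <= n)%N -> strat n !=set0) ->
  (forall C, exists N, forall n, (N <= n)%N ->
    (count (fun p => ~~ `[< X p >]) (fset_set (strat n)) * C
     <= #|` fset_set (strat n)|)%N) ->
  generic R strat X.
Proof.
move=> [N0 ne] cX; apply/cvgrPdist_le => /= eps eps0.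
pose C := Num.bound eps^-1; have [N hN] := cX C.
exists (maxn N0 N) => // n /=; rewrite geq_max => /andP[/ne[p Sp] /hN le].
set s := fset_set (strat n) in le *.
have s0 : (0 < #|` s|)%N.
  rewrite cardfs_gt0; apply/fset0Pn; exists p.
  by rewrite in_fset_set//; exact: mem_set.
have eX : fset_set (X `&` strat n) = [fset q in s | `[< X q >]]%fset.
  apply/fsetP => q; rewrite in_fset_set; last exact: finite_setIr.
  rewrite !inE /= in_fset_set//; apply/idP/andP.
    by move=> /set_mem[Xq Sq]; split; [exact: mem_set|apply/asboolP].
  by move=> [/set_mem Sq /asboolP Xq]; exact: mem_set.
have cE : (#|` [fset q in s | `[< X q >]]%fset| +
    count (fun p => ~~ `[< X p >]) s = #|` s|)%N.
  rewrite -[RHS](count_predC (fun p => `[< X p >]) s); congr (_ + _)%N.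
  rewrite -size_filter; apply: perm_size; apply: uniq_perm.
  - exact: fset_uniq.
  - exact/filter_uniq/fset_uniq.
  - by move=> q; rewrite mem_filter !inE andbC.
rewrite eX; move: cE le s0; set b := count _ _; set g := #|` _| => <- le gb.
have gb0 : 0 < (g + b)%:R :> R by rewrite ltr0n.
have -> : 1 - g%:R / (g + b)%:R = b%:R / (g + b)%:R :> R.
  rewrite -[X in X - _](divff (lt0r_neq0 gb0)) -mulrBl natrD.
  by rewrite [g%:R + _]addrC addrK.
rewrite ger0_norm; last by rewrite divr_ge0.
rewrite ler_pdivrMr//.
have C1 : 1 <= eps * C%:R.
  rewrite -ler_pdivrMl// mulr1; apply: ltW.
  by apply: archi_boundP; rewrite invr_ge0 ltW.
apply: le_trans (_ : eps * (b * C)%:R <= _).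
  by rewrite natrM [b%:R * _]mulrC mulrA ler_peMl.
by rewrite ler_pM2l// ler_nat.
Qed.

End Generic.

(** * Presentations as families of relation words *)

Section RelationWords.
Variables (A : finType) (k : nat) (W : choiceType) (v : W -> seq A).
Implicit Types (p : presentation W k) (st : stratification).

(** This treats both cases at once: [v] is the identity for monoids and [neword_val] for
    semigroups. *)
Definition relation_words p : {ffun 'I_k * bool -> seq A} :=
  [ffun x => v (if x.2 then (tnth p x.1).1 else (tnth p x.1).2)].

Lemma total_size_relation_words st p :
  total_size st (relation_words p) = presentation_size (fun w => size (v w)) st p.
Proof.
pose F i (b : bool) := size (v (if b then (tnth p i).1 else (tnth p i).2)).
case: st => /=; rewrite big_tuple (eq_bigr (fun x => F x.1 x.2));
  try by move=> x _; rewrite ffunE.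
- by rewrite -(pair_bigA _ F); apply: eq_bigr => i _; rewrite big_bool.
- by rewrite -(pair_bigA _ F); apply: eq_bigr => i _; rewrite big_bool.
Qed.

Lemma small_overlap_relation_words L p : small_overlap_family L (relation_words p) ->
  small_overlap (fun u => exists2 r, r \in (p : seq (W * W)) &
    u = v r.1 \/ u = v r.2) L.
Proof.
have sub u : (exists2 r, r \in (p : seq (W * W)) & u = v r.1 \/ u = v r.2) ->
    exists x, u = relation_words p x.
  move=> [r /tnthP[i ->] [] ->]; [exists (i, true)|exists (i, false)];
  by rewrite ffunE.
move=> [h1 h2]; split=> [u /sub/h1//|p1 f q p2 q2 /sub r1 /sub r2].
exact: h2 r1 r2.
Qed.

Hypothesis v_inj : injective v.

Lemma relation_words_inj : injective relation_words.
Proof.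
move=> p q /ffunP pq; apply: eq_from_tnth => i.
have := pq (i, true); have := pq (i, false); rewrite !ffunE /=.
by case: (tnth p i) (tnth q i) => [a b] [c d] /= /v_inj -> /v_inj ->.
Qed.

Variables (e : bool).
Hypothesis v_range : forall u, (e ==> (0 < size u)) <-> exists w, v w = u.

Lemma relation_words_stratum st n w :
  in_stratum e st n w <->
  exists2 p, presentation_size (fun w => size (v w)) st p = n
           & relation_words p = w.
Proof.
split=> [/andP[/forallP pos /eqP tot]|[p pn <-]]; last first.
  apply/andP; split; last by rewrite total_size_relation_words pn.
  by apply/forallP => x; apply/v_range; rewrite ffunE; eexists.
have [f hf] := @choice _ _ (fun x u => v u = w x) (fun x => (v_range _).1 (pos x)).
pose p : presentation W k := [tuple (f (i, true), f (i, false)) | i < k].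
have ep : relation_words p = w.
  by apply/ffunP => -[i b]; rewrite ffunE tnth_mktuple /=; case: b; rewrite hf.
by exists p => //; rewrite -total_size_relation_words ep.
Qed.

Definition stratum st (n : nat) : set (presentation W k) :=
  [set p | presentation_size (fun w => size (v w)) st p = n].

Lemma in_stratum_nonempty st n : 0 < k -> 0 < #|A| -> 2 * k <= n ->
  exists w : {ffun 'I_k * bool -> seq A}, in_stratum e st n w.
Proof.
move=> k0 /card_gt0P[a _] kn; pose i0 := (Ordinal k0, true).
(* For the sum length, all words but one have length 1 and the last takes the rest, which is
   positive because [2 * k <= n]. *)
pose len (x : 'I_k * bool) :=
  if st is SumLength then if x == i0 then n - (2 * k).-1 else 1 else n.
exists [ffun x => nseq (len x) a]; apply/andP; split.
  apply/forallP => x; rewrite ffunE size_nseq /len; apply/implyP => _.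
  by case: (st); [case: ifP => _ //; lia|lia].
have cI : #|{: 'I_k * bool}| = 2 * k by rewrite card_prod card_ord card_bool mulnC.
rewrite /len {len}; case: st => /=; apply/eqP.
  rewrite (bigD1 i0)//= ffunE size_nseq ?eqxx.
  rewrite (eq_bigr (fun=> 1)); last first.
    by move=> x /negbTE xi; rewrite ffunE size_nseq xi.
  have -> : \sum_(x | x != i0) 1 = (2 * k).-1.
    by rewrite sum1_card -cI -(cardC1 i0); apply: eq_card.
  lia.
under eq_bigr do rewrite ffunE size_nseq.
apply/eqP; rewrite eqn_leq; apply/andP; split; first exact/bigmax_leqP.
exact: (leq_bigmax (F := fun=> n) i0).
Qed.

(** The threshold [L] grows with [n], so the generic set quantifies over it existentially. *)
Lemma generic_small_overlap (R : realType) st :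
  1 < #|A| -> 0 < k -> (forall n, finite_set (stratum st n)) ->
  generic R (stratum st) [set p | exists L, small_overlap_family L (relation_words p)].
Proof.
move=> A2 k0 fin; apply: generic_of_count => //.
  exists (2 * k) => n kn.
  have [w /relation_words_stratum[p pn _]] := in_stratum_nonempty st k0 (ltnW A2) kn.
  by exists p.
move=> C; have [|N hN] := @count_not_small_overlap_family A ('I_k * bool)%type e st C A2.
  by rewrite card_prod card_ord card_bool muln_gt0 k0.
exists N => n /hN[L hL].
set s := fset_set _.
have := hL (map relation_words s); rewrite size_map count_map => le.
apply: (leq_trans _ (le _ _)).
- rewrite leq_mul2r; apply/orP; right; apply: sub_count => p /=.
  by apply: contraNN => /asboolP so; apply/asboolP; exists L.
- by rewrite map_inj_uniq ?fset_uniq//; exact: relation_words_inj.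
- move=> w; apply/mapP/idP => [[p + ->]|/relation_words_stratum[p pn <-]].
    rewrite in_fset_set// => /set_mem pn.
    by apply/relation_words_stratum; exists p.
  by exists p => //; rewrite in_fset_set//; exact: mem_set.
Qed.

End RelationWords.

Theorem theorem6 (R : realType) (A : finType) (k : nat)
  (hA : (2 <= #|A|)%N) (hk : (0 < k)%N) (st : stratification) :
  generically R (@monoid_stratum A k st)
    (fun p : monoid_presentation A k =>
       let M := presented_monoid p in
       [/\ nontrivial M, torsion_free M & J_trivial M] /\
       [/\ ~ is_group M, ~ is_inverse M & ~ is_regular M])
  /\
  generically R (@semigroup_stratum A k st)
    (fun p : semigroup_presentation A k =>
       let S := presented_semigroup p in
       [/\ nontrivial S, torsion_free S & J_trivial S] /\
       [/\ ~ is_group S, ~ is_inverse S & ~ is_regular S]).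
Proof.
have /card_gt0P[a _] : 0 < #|A| by exact: ltnW.
split.
  exists [set p | exists L, small_overlap_family L (relation_words (fun w : word A => w) p)].
    apply: (@generic_small_overlap A k (word A) (fun w => w) _ false) => //.
      by move=> u; split=> // _; exists u.
    exact: monoid_stratum_finite.
  by move=> p /= [L /small_overlap_relation_words so]; exact: presented_monoid_properties so.
exists [set p | exists L, small_overlap_family L (relation_words (@neword_val A) p)].
  apply: (@generic_small_overlap A k (neword A) (@neword_val A) _ true) => //.
  - exact: val_inj.
  - move=> u; split=> [u0|[w <-]]; last by rewrite lt0n size_eq0 neword_neq0.
    have u1 : u != [::] by rewrite -size_eq0 -lt0n.
    by exists (NEWord u1).
  - exact: semigroup_stratum_finite.
by move=> p /= [L /small_overlap_relation_words so]; exact: presented_semigroup_properties so.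
Qed.
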